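(* Let $a \in (0,\infty)$ and $b\in [1,\infty)$. Then $W_{a,b}$ is subnormal if and only if $a \leqslant b=1$. If $a=b=1$, then $W_{a,b}$ is an isometry, hence of type I. If $a<b=1$, then $W_{a,b}$ is of type II. Moreover, if $W_{a,b}$ is subnormal, then $\|W_{a,b}\|=1$.
   Context: $\mathbb Z_+=\{0,1,2,\dots\}$, $\mathbb R_+=[0,\infty)$; $\boldsymbol B(\mathcal H)$ denotes bounded linear operators on a complex Hilbert space $\mathcal H$; $\{e_n\}_{n=0}^\infty$ is the standard orthonormal basis of $\ell^2=\ell^2(\mathbb Z_+)$. Unilateral weighted shift: for a bounded sequence $\boldsymbol\lambda=\{\lambda_n\}_{n=0}^\infty\subseteq(0,\infty)$, $W_{\boldsymbol\lambda}\in\boldsymbol B(\ell^2)$ is the operator with $W_{\boldsymbol\lambda}e_n=\lambda_n e_{n+1}$, $n\in\mathbb Z_+$. Put $\hat\lambda_0=1$ and $\hat\lambda_n=\lambda_0^2\cdots\lambda_{n-1}^2$ for $n\geqslant1$. For $a\in(0,\infty)$ and $b\in[1,\infty)$, $W_{a,b}\in\boldsymbol B(\ell^2)$ is the unilateral weighted shift with weights $\lambda_0=\sqrt a$ and $\lambda_n=\sqrt{\frac{1+n(b-1)}{1+(n-1)(b-1)}}$ for $n\geqslant1$. CPD: $T\in\boldsymbol B(\mathcal H)$ is conditionally positive definite (CPD) if for every $h\in\mathcal H$ the sequence $\gamma_n=\|T^nh\|^2$ satisfies $\sum_{i,j=0}^k\gamma_{i+j}\alpha_i\bar\alpha_j\geqslant0$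 for all finite complex sequences $\alpha_0,\dots,\alpha_k$ with $\sum_{j=0}^k\alpha_j=0$. Every subnormal operator is CPD. Scalar representing triplet: let $Q_0=Q_1=0$ and $Q_n(x)=\sum_{j=0}^{n-2}(n-j-1)x^j$ for $n\geqslant2$. It is known that $W_{\boldsymbol\lambda}$ is CPD if and only if there are $\mathfrak b\in\mathbb R$, $\mathfrak c\in\mathbb R_+$ and a compactly supported finite positive Borel measure $\nu$ on $\mathbb R_+$ with $\nu(\{1\})=0$ such that $\hat\lambda_n=1+\mathfrak bn+\mathfrak cn^2+\int_{\mathbb R_+}Q_n\,\mathrm d\nu$ for all $n\in\mathbb Z_+$; the triplet $(\mathfrak b,\mathfrak c,\nu)$ is then unique and is called the scalar representing triplet of $W_{\boldsymbol\lambda}$. Types: a CPD unilateral weighted shift with scalar representing triplet $(\mathfrak b,\mathfrak c,\nu)$ is of type I if $\nu=0$ and $\mathfrak c=0$; of type II if $\operatorname{supp}\nu=\{0\}$ and $\mathfrak c=0$; of type III if $\operatorname{supp}\nu\nsubseteq\{0\}$ or $\mathfrak c\neq0$. *)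

(* Defs.v *)
From HB Require Import structures.
From mathcomp Require Import all_boot all_order all_algebra.
From mathcomp Require Import complex.
From mathcomp Require Import ring lra.
From mathcomp Require Import all_classical all_reals all_analysis.

Set Implicit Arguments.
Unset Strict Implicit.
Unset Printing Implicit Defensive.

Import Order.TTheory GRing.Theory Num.Theory.
Import numFieldNormedType.Exports.
Local Open Scope classical_set_scope.
Local Open Scope complex_scope.
Local Open Scope ring_scope.

Local Notation normc := ComplexField.Normc.normc.
Local Notation Re := (@complex.Re _).
Local Notation Im := (@complex.Im _).

(* The complex field R[i] with the topology and norm of its modulus; the norm
   of R[i], and of every normed module over it, takes its (nonnegative real)
   values in R[i], where x <= y means that y - x is a nonnegative real. *)
HB.instance Definition _ (R : realType) :=
  PseudoPointedMetric.copy R[i] (R[i])^o.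
HB.instance Definition _ (R : realType) := NormedModule.copy R[i] (R[i])^o.

Section cplx.
Variable R : realType.
Implicit Types z w : R[i].

Lemma normcE z : `|z| = (normc z)%:C. Proof. by []. Qed.

Lemma normc_ge0 z : 0 <= normc z.
Proof. by case: z => a b; rewrite sqrtr_ge0. Qed.

Lemma Re_le_normc z : `|Re z| <= normc z.
Proof.
case: z => a b /=; rewrite -sqrtr_sqr ler_wsqrtr// lerDl sqr_ge0//.
Qed.

Lemma Im_le_normc z : `|Im z| <= normc z.
Proof.
case: z => a b /=; rewrite -sqrtr_sqr ler_wsqrtr// lerDr sqr_ge0//.
Qed.

Lemma normc_le_ReIm z : normc z <= `|Re z| + `|Im z|.
Proof.
case: z => a b /=; rewrite -ler_sqr ?nnegrE ?sqrtr_ge0 ?addr_ge0//.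
rewrite sqr_sqrtr ?addr_ge0 ?sqr_ge0// sqrrD !real_normK ?num_real//.
by rewrite addrAC lerDl mulrn_wge0// mulr_ge0.
Qed.

Lemma complex_complete (F : set_system R[i]) :
  ProperFilter F -> cauchy F -> cvg F.
Proof.
move=> FF /cauchy_ballP Fc.
have HF (g : R[i] -> R) :
    (forall z w, `|g z - g w| <= normc (z - w)) -> cvg (g @ F).
  move=> gl; apply/cauchy_cvgP/cauchy_ballP => e e0.
  have e0' : 0 < e%:C by rewrite ltcR.
  rewrite near_map2; have := Fc _ e0'.
  apply: filterS => -[x y] /=; rewrite -!ball_normE /= => h.
  apply: le_lt_trans (gl _ _) _; by rewrite normcE ltcR in h.
have cR : cvg (Re @ F).
  by apply: HF => z w; rewrite -(raddfB (@complex.Re R)); exact: Re_le_normc.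
have cI : cvg (Im @ F).
  by apply: HF => z w; rewrite -(raddfB (@complex.Im R)); exact: Im_le_normc.
apply/cvg_ex; exists (Complex (lim (Re @ F)) (lim (Im @ F))).
apply/(@cvgrPdist_lt _ _ _ F FF id) => e.
rewrite ltcE /= => /andP[/eqP Ime Ree].
have e2 : 0 < Re e / 2 by rewrite divr_gt0.
move/cvgrPdist_lt: cR => /(_ _ e2) cR.
move/cvgrPdist_lt: cI => /(_ _ e2) cI.
near=> z.
rewrite normcE ltcE /= Ime eqxx /=.
apply: le_lt_trans (normc_le_ReIm _) _.
rewrite (splitr (Re e)) (raddfB (@complex.Re R)) /= (raddfB (@complex.Im R)) /=.
apply: ltrD; near: z; [exact: cR|exact: cI].
Unshelve. all: by end_near. Qed.

HB.instance Definition _ := Uniform_isComplete.Build R[i] complex_complete.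

End cplx.

Section complex_series.
Variable R : realType.
Implicit Types z w : R[i].

Lemma normc_ler_dist z w : `|normc z - normc w| <= normc (z - w).
Proof.
have h u v : normc (u : R[i]) - normc v <= normc (u - v).
  by rewrite lerBlDr -{1}(subrK v u) le_normcD.
rewrite ler_norml h andbT lerNl opprB (le_trans (h _ _))//.
by rewrite -opprB normcN.
Qed.

Lemma cvg_normc T (F : set_system T) {FF : Filter F} (f : T -> R[i]) z :
  f @ F --> z -> normc (f t) @[t --> F] --> normc z.
Proof.
move=> /cvgrPdist_le fz; apply/cvgrPdist_le => e e0.
have /fz : 0 < e%:C by rewrite ltcR.
apply: filterS => t; rewrite normcE lecR; exact: le_trans (normc_ler_dist _ _).
Qed.

Lemma cvg_conj T (F : set_system T) {FF : Filter F} (f : T -> R[i]) z :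
  f @ F --> z -> (f t)^* @[t --> F] --> (z^* : R[i]).
Proof.
move=> /cvgrPdist_le fz; apply/cvgrPdist_le => e e0.
by apply: filterS (fz e e0) => t; rewrite -rmorphB norm_conjC.
Qed.

Lemma cvg_real_complex T (F : set_system T) {FF : Filter F} (f : T -> R)
    (x : R) :
  f @ F --> x -> (f t)%:C @[t --> F] --> (x%:C : R[i]).
Proof.
move=> /cvgrPdist_le fz; apply/cvgrPdist_le => e.
rewrite ltcE /= => /andP[/eqP Ime Ree].
apply: filterS (fz _ Ree) => t h.
by rewrite -raddfB /= normcE lecE /= Ime eqxx /= expr0n /= addr0 sqrtr_sqr.
Qed.

Lemma is_cvg_series_normc (u : nat -> R[i]) :
  cvgn (series (fun n => normc (u n))) -> cvgn (series u).
Proof.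
move=> /cauchy_cvgP/cauchy_seriesP cu; apply/cauchy_cvgP/cauchy_seriesP => e.
rewrite ltcE /= => /andP[/eqP Ime Ree].
apply: filterS (cu _ Ree) => -[m n] /= h.
apply: le_lt_trans (ler_norm_sum _ _ _) _.
have -> : \sum_(m <= i < n) `|u i| = (\sum_(m <= i < n) normc (u i))%:C.
  by rewrite raddf_sum.
rewrite ltcE /= Ime eqxx /=; apply: le_lt_trans h; exact: ler_norm.
Qed.

End complex_series.

Section l2_def.
Variable R : realType.
Implicit Types f g : nat -> R[i].

Definition square_summable f := cvgn (series (fun n => normc (f n) ^+ 2)).

Definition square_summable_pred : {pred nat -> R[i]} :=
  fun f => `[< square_summable f >].

Lemma sqn_ge0 f n : 0 <= normc (f n) ^+ 2. Proof. exact: sqr_ge0. Qed.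

Lemma square_summable_bounded f (M : R) :
  (forall n, \sum_(0 <= k < n) normc (f k) ^+ 2 <= M) -> square_summable f.
Proof.
move=> fM; apply: nondecreasing_is_cvgn.
  by apply: nondecreasing_series => n _ _; exact: sqn_ge0.
by exists M => _ [n _ <-]; exact: fM.
Qed.

Lemma normcM_le z w : normc (z * w : R[i]) <= normc z ^+ 2 + normc w ^+ 2.
Proof.
rewrite ComplexField.Normc.normcM.
have z0 := normc_ge0 z; have w0 := normc_ge0 w.
by move: (normc z) (normc w) z0 w0 => x y x0 y0; nra.
Qed.

Lemma normcD_sq_le z w :
  normc (z + w : R[i]) ^+ 2 <= 2 * normc z ^+ 2 + 2 * normc w ^+ 2.
Proof.
have := le_normcD z w; have := normc_ge0 (z + w).
move: (normc z) (normc w) (normc (z + w)) => x y s s0 sxy.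
have : s ^+ 2 <= (x + y) ^+ 2 by rewrite lerXn2r ?nnegrE// (le_trans s0).
by have := sqr_ge0 (x - y); nra.
Qed.

Lemma square_summable_submod_closed : submod_closed square_summable_pred.
Proof.
split.
  apply/asboolP/(@square_summable_bounded _ 0) => n.
  rewrite big1// => k _; rewrite [_ k]/(0 : R[i]).
  by rewrite ComplexField.Normc.normc0 expr0n.
move=> a f g /asboolP sf /asboolP sg; apply/asboolP.
have key : cvgn (series ((2 * normc a ^+ 2) *: (fun n => normc (f n) ^+ 2) +
                         2 *: (fun n => normc (g n) ^+ 2) : R ^nat)).
  by apply: is_cvg_seriesD; apply: is_cvg_seriesZ.
apply: series_le_cvg key => n; first exact: sqn_ge0.
  by rewrite addr_ge0// mulr_ge0 ?sqr_ge0// mulr_ge0 ?sqr_ge0.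
apply: le_trans (normcD_sq_le _ _) _; rewrite lerD2r.
by rewrite ComplexField.Normc.normcM exprMn mulrA.
Qed.

HB.instance Definition _ :=
  GRing.isSubmodClosed.Build R[i] (nat -> R[i]) square_summable_pred
    square_summable_submod_closed.

End l2_def.

Record l2 (R : realType) := L2Seq {
  l2_seq :> nat -> R[i];
  l2_seqP : l2_seq \in @square_summable_pred R }.

HB.instance Definition _ (R : realType) := [isSub for @l2_seq R].
HB.instance Definition _ (R : realType) := [Choice of l2 R by <:].
HB.instance Definition _ (R : realType) :=
  [SubChoice_isSubLmodule of l2 R by <:].

Section dot_norm.
Variables (C : numClosedFieldType) (U : lmodType C).
Variable form : {dot U for @Num.conj C}.
Implicit Types u v : U.

Definition dot_norm u : C := sqrtC (form u u).

Lemma dot_normK u : dot_norm u ^+ 2 = form u u. Proof. exact: sqrtCK. Qed.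

Lemma dot_norm_ge0 u : 0 <= dot_norm u. Proof. by rewrite sqrtC_ge0. Qed.

Lemma dot_cauchy_schwarz u v : `|form u v| <= dot_norm u * dot_norm v.
Proof.
rewrite -ler_sqr ?nnegrE ?mulr_ge0 ?dot_norm_ge0// exprMn !dot_normK.
have [->|v0] := eqVneq v 0.
  by rewrite linear0r normr0 expr0n mulr_ge0 ?dnorm_ge0.
have vv0 : 0 < form v v by rewrite dnorm_gt0.
pose a := form u v / form v v; pose w := u - a *: v.
have wv : form w v = 0 by rewrite linearBl linearZl_LR/= divfK ?gt_eqF// subrr.
have -> : u = w + a *: v by rewrite subrK.
rewrite hnormDd/=; last by rewrite linearZr_LR/= wv mulr0.
rewrite dnormZ linearDl/= wv add0r linearZl_LR/= normrM exprMn.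
rewrite (ger0_norm (dnorm_ge0 _ _)) mulrDl expr2 mulrA lerDr.
by rewrite mulr_ge0 ?dnorm_ge0.
Qed.

Lemma dot_normD u v : dot_norm (u + v) <= dot_norm u + dot_norm v.
Proof.
rewrite -ler_sqr ?nnegrE ?addr_ge0 ?dot_norm_ge0//.
rewrite sqrrD !dot_normK dnormD /= addrAC lerD2r// lerD2l.
have -> : form u v + (form u v)^* = 'Re (form u v) *+ 2.
  by rewrite ReE -mulr_natr divfK// pnatr_eq0.
rewrite lerMn2r/=; apply: le_trans (dot_cauchy_schwarz u v).
exact: (leif_Re_Creal _).1.
Qed.

Lemma dot_normZ (a : C) u : dot_norm (a *: u) = `|a| * dot_norm u.
Proof.
by rewrite /dot_norm dnormZ sqrtCM ?nnegrE ?sqr_ge0 ?dnorm_ge0// sqrCK.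
Qed.

Lemma dot_norm_eq0 u : dot_norm u = 0 -> u = 0.
Proof. by move/eqP; rewrite sqrt_dnorm_eq0 => /eqP. Qed.

End dot_norm.

Section l2_dot.
Variable R : realType.
Implicit Types f g h : l2 R.

Lemma l2_square_summable f : square_summable f.
Proof. by have /asboolP := l2_seqP f. Qed.

Lemma l2_addE f g n : (f + g) n = f n + g n. Proof. by []. Qed.
Lemma l2_scaleE (a : R[i]) f n : (a *: f) n = a * f n. Proof. by []. Qed.
Lemma l2_subE f g n : (f - g) n = f n - g n. Proof. by []. Qed.
Lemma l2_eqP f g : (forall n, f n = g n) -> f = g.
Proof. by move=> fg; apply/val_inj/funext. Qed.

Definition l2_dot f g : R[i] := limn (series (fun n => f n * (g n)^*)).

Lemma normc_conj (z : R[i]) : normc (z^*)%R = normc z.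
Proof. by case: z => a b /=; rewrite sqrrN. Qed.

Lemma is_cvg_l2_dot f g : cvgn (series (fun n => f n * (g n)^*)).
Proof.
apply: is_cvg_series_normc.
have key := is_cvg_seriesD (@l2_square_summable f) (@l2_square_summable g).
apply: series_le_cvg key => n; first exact: normc_ge0.
  by rewrite addr_ge0// sqr_ge0.
by apply: le_trans (normcM_le _ _) _; rewrite normc_conj.
Qed.

Lemma l2_dot_linearl g (a : R[i]) f h :
  l2_dot (a *: f + h) g = a * l2_dot f g + l2_dot h g.
Proof.
rewrite /l2_dot -[a * _]/(a *: _) -lim_seriesZ; last exact: is_cvg_l2_dot.
rewrite -lim_seriesD;
  [|exact/is_cvg_seriesZ/is_cvg_l2_dot|exact: is_cvg_l2_dot].
congr (limn (series _)); apply/funext => n.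
by rewrite l2_addE l2_scaleE mulrDl -mulrA.
Qed.

Lemma l2_dotC f g : l2_dot f g = ((l2_dot g f)^*)%R.
Proof.
have h := cvg_conj (@is_cvg_l2_dot g f).
rewrite {1}/l2_dot; apply: cvg_lim; first exact: norm_hausdorff.
rewrite (_ : series _ = fun n => ((series (fun k => g k * (f k)^*) n)^*)%R).
  exact: h.
apply/funext => n; rewrite /series /= rmorph_sum/=; apply: eq_bigr => k _.
by rewrite rmorphM/= conjCK mulrC.
Qed.

Lemma l2_dotr_linear f (a : R[i]) g h :
  l2_dot f (a *: g + h) = (a^*)%R * l2_dot f g + l2_dot f h.
Proof.
by rewrite l2_dotC l2_dot_linearl rmorphD rmorphM /= -!l2_dotC.
Qed.

Lemma l2_dotE f : l2_dot f f = (limn (series (fun n => normc (f n) ^+ 2)))%:C.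
Proof.
rewrite /l2_dot; apply: cvg_lim; first exact: norm_hausdorff.
have h := cvg_real_complex (@l2_square_summable f).
rewrite (_ : series _ = fun n => (series (fun k => normc (f k) ^+ 2) n)%:C).
  exact: h.
apply/funext => n; rewrite /series /= raddf_sum; apply: eq_bigr => k _.
by rewrite -normCK normcE -(rmorphXn (real_complex R)).
Qed.

Lemma l2_partial_sum_le f n :
  \sum_(0 <= k < n) normc (f k) ^+ 2 <=
  limn (series (fun n => normc (f n) ^+ 2)).
Proof.
apply: nondecreasing_cvgn_le; last exact: l2_square_summable.
by apply: nondecreasing_series => k _ _; exact: sqr_ge0.
Qed.

Lemma l2_dot_gt0 f : f != 0 -> 0 < l2_dot f f.
Proof.
move=> f0; rewrite l2_dotE ltcR.
have [n fn0] : exists n, f n != 0.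
  apply: contrapT => /forallNP h; move/eqP: f0; apply; apply: l2_eqP => n.
  by have /negP := h n; rewrite negbK => /eqP.
have : 0 < normc (f n) ^+ 2.
  rewrite exprn_gt0// lt_neqAle normc_ge0 andbT eq_sym.
  by apply: contra fn0 => /eqP/ComplexField.Normc.eq0_normc ->.
move=> /lt_le_trans; apply; apply: le_trans (l2_partial_sum_le f n.+1).
by rewrite big_nat_recr//= lerDr sumr_ge0// => k _; exact: sqr_ge0.
Qed.

Lemma l2_dot_is_bilinear :
  bilinear_for *%R (@Num.conj R[i] \; *%R) l2_dot.
Proof.
split=> [g a f h|f a g h] /=; [exact: l2_dot_linearl|exact: l2_dotr_linear].
Qed.

HB.instance Definition _ := bilinear_isBilinear.Build R[i] (l2 R) (l2 R) R[i]
  *%R (@Num.conj R[i] \; *%R) l2_dot l2_dot_is_bilinear.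

Lemma l2_dot_hermitian f g : l2_dot f g = (-1) ^+ false * Num.conj (l2_dot g f).
Proof. by rewrite expr0 mul1r l2_dotC. Qed.

HB.instance Definition _ := isHermitianSesquilinear.Build R[i] (l2 R) false
  (@Num.conj R[i]) l2_dot l2_dot_hermitian.
HB.instance Definition _ := isDotProduct.Build R[i] (l2 R) l2_dot l2_dot_gt0.

End l2_dot.

(* Complex Hilbert spaces; inner is linear in its first argument. *)
HB.mixin Record CompleteNormedModule_isHilbert (R : realType) H
    & CompleteNormedModule R[i] H := {
  inner : {dot H for @Num.conj R[i]};
  normr2_inner : forall x : H, `|x| ^+ 2 = inner x x }.

#[short(type="hilbertType")]
HB.structure Definition Hilbert (R : realType) :=
  {H of CompleteNormedModule R[i] H & CompleteNormedModule_isHilbert R H}.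

Section l2_norm.
Variable R : realType.
Implicit Types f g h : l2 R.

HB.instance Definition _ := Lmodule_isNormed.Build R[i] (l2 R)
  (dot_normD (@l2_dot R)) (dot_normZ (@l2_dot R))
  (@dot_norm_eq0 _ _ (@l2_dot R)).

Lemma l2_normr2 f : `|f| ^+ 2 = l2_dot f f.
Proof. exact: dot_normK. Qed.

Lemma l2_norm_leP f (e : R) : 0 <= e ->
  (forall n, \sum_(0 <= k < n) normc (f k) ^+ 2 <= e ^+ 2) <-> `|f| <= e%:C.
Proof.
move=> e0.
rewrite -[X in _ <-> is_true X]ler_sqr ?nnegrE ?lecR// l2_normr2 l2_dotE.
rewrite -(rmorphXn (real_complex R)) lecR; split=> [h|h n].
  apply: limr_le; first exact: l2_square_summable.
  by near=> n; exact: h.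
exact: le_trans (l2_partial_sum_le _ _) h.
Unshelve. all: by end_near. Qed.

Lemma l2_coord_le f n (e : R) : `|f| < e%:C -> normc (f n) < e.
Proof.
have e0 : `|f| < e%:C -> 0 <= e.
  by move=> h; rewrite -ler0c (le_trans _ (ltW h)).
move=> h; have {e0} e0 := e0 h; move: h.
rewrite -ltr_sqr ?nnegrE ?lecR// l2_normr2 l2_dotE -(rmorphXn (real_complex R)).
rewrite ltcR => h.
rewrite -ltr_sqr ?nnegrE ?normc_ge0//; apply: le_lt_trans h.
apply: le_trans (l2_partial_sum_le f n.+1).
by rewrite big_nat_recr//= lerDr sumr_ge0// => k _; exact: sqr_ge0.
Qed.

Lemma cvg_sum_nat T (F : set_system T) {FF : Filter F} (u : nat -> T -> R)
    (a : nat -> R) n : (forall k, u k @ F --> a k) ->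
  \sum_(0 <= k < n) u k t @[t --> F] --> \sum_(0 <= k < n) a k.
Proof.
move=> ua; elim: n => [|n IH].
  by rewrite big_nil; under eq_cvg do rewrite big_nil; exact: cvg_cst.
rewrite big_nat_recr//=; under eq_cvg do rewrite big_nat_recr//=.
exact: cvgD.
Qed.

Lemma l2_complete (F : set_system (l2 R)) :
  ProperFilter F -> cauchy F -> cvg F.
Proof.
move=> FF /cauchy_ballP Fc.
have Fce (e : R) : 0 < e -> \forall f & g \near F, `|f - g| < e%:C.
  move=> e0; have := Fc e%:C; rewrite ltcR => /(_ e0).
  by apply: filterS => -[f g]; rewrite -ball_normE.
have cc n : cvg ((fun f : l2 R => f n) @ F).
  apply/cauchy_cvgP/cauchy_ballP => e; rewrite near_map2.
  rewrite ltcE /= => /andP[/eqP Ime Ree].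
  apply: filterS (Fce _ Ree) => -[f g] /= h.
  rewrite -ball_normE /= -l2_subE normcE ltcE /= Ime eqxx /=.
  exact: (l2_coord_le n h).
pose x : nat -> R[i] := fun n => lim ((fun f : l2 R => f n) @ F).
have key (e : R) : 0 < e -> F [set f : l2 R | forall n,
    \sum_(0 <= k < n) normc (f k - x k) ^+ 2 <= e ^+ 2].
  move=> e0; apply: (@filterS _ F _ (fun f => \forall g \near F,
    `|f - g| < e%:C)); last exact: nearP_dep (Fce _ e0).
  move=> f fg n.
  have cvs : \sum_(0 <= k < n) normc (f k - (g : l2 R) k) ^+ 2 @[g --> F] -->
             \sum_(0 <= k < n) normc (f k - x k) ^+ 2.
    apply: cvg_sum_nat => k.
    have h : normc (f k - (g : l2 R) k) @[g --> F] --> normc (f k - x k).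
      by apply: cvg_normc; apply: cvgB; [exact: cvg_cst|exact: cc].
    by rewrite expr2; under eq_cvg do rewrite expr2; exact: cvgM.
  apply: cvgr_to_le cvs _; apply: filterS fg => g /ltW.
  by move/l2_norm_leP => -/(_ (ltW e0) n).
have [f0 f0x] := filter_ex (key 1 ltr01).
have fxs : (f0 : nat -> R[i]) - x \in @square_summable_pred R.
  by apply/asboolP/square_summable_bounded => n; exact: f0x.
have xs : x \in @square_summable_pred R.
  by rewrite -(subKr (f0 : nat -> R[i]) x) rpredB// l2_seqP.
apply/cvg_ex; exists (L2Seq xs).
apply/(@cvgrPdistC_le _ _ _ F FF id) => e.
rewrite ltcE /= => /andP[/eqP Ime Ree].
have -> : e = (complex.Re e)%:C by case: e Ime {Ree} => a b /= ->.
apply: filterS (key _ Ree) => f h.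
by apply/l2_norm_leP => //; exact: ltW.
Qed.

HB.instance Definition _ := Uniform_isComplete.Build (l2 R) l2_complete.
HB.instance Definition _ :=
  CompleteNormedModule_isHilbert.Build R (l2 R) l2_normr2.

End l2_norm.

(* A linear map between normed modules is bounded iff it is continuous
   (linear_bounded_continuous). *)
#[short(type="boundedOp")]
HB.structure Definition BoundedOp (K : numFieldType) (E F : normedModType K) :=
  {T of @GRing.Linear K E F *:%R T & @isContinuous E F T}.

Record shift_weights (R : realType) := ShiftWeights {
  weight :> nat -> R;
  weight_gt0 : forall n, 0 < weight n;
  weight_bounded : exists M, forall n, weight n <= M }.

Section weighted_shift.
Variables (R : realType) (lam : shift_weights R).
Implicit Types f g : l2 R.

Definition wshift_seq f : nat -> R[i] :=
  fun n => if n is m.+1 then (lam m)%:C * f m else 0.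

Lemma wshift_seq_sum_le M f n : (forall n, lam n <= M) ->
  \sum_(0 <= k < n) normc (wshift_seq f k) ^+ 2 <=
  M ^+ 2 * \sum_(0 <= k < n) normc (f k) ^+ 2.
Proof.
move=> lamM; case: n => [|n]; first by rewrite !big_nil mulr0.
rewrite big_nat_recl// [wshift_seq f 0]/(0 : R[i]).
rewrite ComplexField.Normc.normc0 expr0n add0r.
rewrite [X in _ <= _ * X]big_nat_recr//= mulrDr mulr_sumr.
rewrite -[leLHS]addr0; apply: lerD; last by rewrite mulr_ge0 ?sqr_ge0.
apply: ler_sum => k _.
rewrite ComplexField.Normc.normcM exprMn ler_wpM2r ?sqr_ge0//.
rewrite /= expr0n addr0 sqrtr_sqr real_normK ?num_real//.
have l0 := ltW (weight_gt0 lam k).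
by rewrite ler_sqr ?nnegrE// (le_trans l0).
Qed.

Lemma wshift_seq_l2 f : wshift_seq f \in @square_summable_pred R.
Proof.
have [M lamM] := weight_bounded lam.
apply/asboolP/(@square_summable_bounded _ _
  (M ^+ 2 * limn (series (fun n => normc (f n) ^+ 2)))) => n.
apply: le_trans (wshift_seq_sum_le _ _ lamM) _.
by rewrite ler_wpM2l ?sqr_ge0//; exact: l2_partial_sum_le.
Qed.

Definition wshift f : l2 R := L2Seq (wshift_seq_l2 f).

Lemma wshift_is_linear : linear wshift.
Proof.
move=> a f g; apply: l2_eqP => -[|n]; rewrite l2_addE l2_scaleE.
  by rewrite mulr0 addr0.
by rewrite [RHS]/= -[wshift _ _]/(_ * (a * f n + g n)) mulrDr mulrCA.
Qed.

HB.instance Definition _ :=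
  GRing.isLinear.Build R[i] (l2 R) (l2 R) *:%R wshift wshift_is_linear.

Lemma wshift_norm_le M f : (forall n, lam n <= M) -> `|wshift f| <= M%:C * `|f|.
Proof.
move=> lamM.
have M0 : 0 <= M by rewrite (le_trans _ (lamM 0%N))// ltW// weight_gt0.
rewrite -ler_sqr ?nnegrE ?mulr_ge0 ?lecR// exprMn !l2_normr2 !l2_dotE.
rewrite -(rmorphXn (real_complex R)) -(rmorphM (real_complex R)) lecR.
apply: limr_le; first exact: l2_square_summable.
near=> n; apply: le_trans (wshift_seq_sum_le _ _ lamM) _.
by rewrite ler_wpM2l ?sqr_ge0//; exact: l2_partial_sum_le.
Unshelve. all: by end_near. Qed.

Lemma wshift_continuous : continuous wshift.
Proof.
have [M lamM] := weight_bounded lam.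
have M0 : 0 < M by rewrite (lt_le_trans _ (lamM 0%N))// weight_gt0.
apply/bounded_linear_continuous/linear_boundedP; exists M%:C.
split; first by rewrite realE lecR ltW.
move=> r Mr f; apply: le_trans (wshift_norm_le f lamM) _.
by rewrite ler_wpM2r// ltW.
Qed.

HB.instance Definition _ :=
  isContinuous.Build (l2 R) (l2 R) wshift wshift_continuous.

End weighted_shift.

Section basis.
Variable R : realType.

Definition l2_basis_seq (n : nat) : nat -> R[i] := fun k => (k == n)%:R.

Lemma l2_basis_seq_l2 n : l2_basis_seq n \in @square_summable_pred R.
Proof.
apply/asboolP/(@square_summable_bounded _ _ 1) => m.
have h : \sum_(0 <= k < m) normc (l2_basis_seq n k) ^+ 2 =
         \sum_(0 <= k < m | k == n) 1 :> R.
  rewrite [RHS]big_mkcond; apply: eq_bigr => k _; rewrite /l2_basis_seq.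
  case: eqP => _; rewrite ?ComplexField.Normc.normc0 ?expr0n//.
  by rewrite ComplexField.Normc.normc1 expr1n.
rewrite h big_nat1_eq; case: ifP => // _; exact: ler01.
Qed.

Definition l2_basis n : l2 R := L2Seq (l2_basis_seq_l2 n).

(* The equation that determines the weighted shift. *)
Lemma wshift_basis (lam : shift_weights R) n :
  wshift lam (l2_basis n) = (lam n)%:C *: l2_basis n.+1.
Proof.
apply: l2_eqP => -[|k]; rewrite l2_scaleE /= /l2_basis_seq ?mulr0// eqSS.
by case: eqP => [->//|_]; rewrite !mulr0.
Qed.

End basis.

Section operators.
Variables (R : realType) (H : hilbertType R).
Implicit Types T S : boundedOp H H.

Definition isometric T := forall x : H, `|T x| = `|x|.

Definition adjoint T S := forall x y : H, inner (T x) y = inner x (S y).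

Definition normal_op T :=
  exists2 S : boundedOp H H, adjoint T S & forall x : H, T (S x) = S (T x).

(* The norm takes its values in R[i], hence the projection on R. *)
Definition opnorm T : R :=
  sup [set complex.Re `|T x| | x in [set x : H | `|x| <= 1]].

Definition cpd T := forall (h : H) (k : nat) (alpha : nat -> R[i]),
  \sum_(j < k.+1) alpha j = 0 ->
  0 <= \sum_(i < k.+1) \sum_(j < k.+1)
         `|iter (i + j) T h| ^+ 2 * alpha i * ((alpha j)^*)%R.

End operators.

(* K contains H up to the isometric embedding V, and N extends T. *)
Definition subnormal (R : realType) (H : hilbertType R) (T : boundedOp H H) :=
  exists (K : hilbertType R) (V : {linear H -> K}) (N : boundedOp K K),
    [/\ forall x y : H, inner (V x) (V y) = inner x y,
        normal_op N & forall x : H, V (T x) = N (V x)].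

Section triplet.
Variable R : realType.
Implicit Types (lam : shift_weights R) (nu : {finite_measure set R -> \bar R}).

Definition lambda_hat lam (n : nat) : R := \prod_(i < n) lam i ^+ 2.

(* The sum is empty for n = 0 and n = 1. *)
Definition Qpoly (n : nat) (x : R) : R :=
  \sum_(j < n.-1) (n - j - 1)%:R * x ^+ j.

Definition msupport nu : set R :=
  [set x | forall U : set R, open U -> U x -> (0 < nu U)%E].

(* A measure on the half-line is a measure on R that is null outside it. Being
   a representing triplet is a relation: a triplet of a shift is unique. *)
Definition scalar_triplet lam (b c : R) nu :=
  [/\ 0 <= c, nu (~` `[0, +oo[) = 0%E, compact (msupport nu), nu [set 1] = 0%E &
      forall n, (lambda_hat lam n)%:E =
        ((1 + b * n%:R + c * n%:R ^+ 2)%:E +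
          \int[nu]_(x in `[0%R, +oo[) (Qpoly n x)%:E)%E].

(* nu = 0 as a Borel measure: its values on other sets are meaningless. *)
Definition type_I lam := cpd (wshift lam) /\
  exists b c nu, [/\ scalar_triplet lam b c nu,
    forall A : set R, measurable A -> nu A = 0%E & c = 0].

Definition type_II lam := cpd (wshift lam) /\
  exists b c nu, [/\ scalar_triplet lam b c nu, msupport nu = [set 0] & c = 0].

End triplet.

Section Wab.
Variables (R : realType) (a b : R).

Definition Wab_weight (n : nat) : R :=
  if n is m.+1 then
    Num.sqrt ((1 + n%:R * (b - 1)) / (1 + m%:R * (b - 1)))
  else Num.sqrt a.

Hypotheses (a_gt0 : 0 < a) (b_ge1 : 1 <= b).

Let den_gt0 (n : nat) : 0 < 1 + n%:R * (b - 1).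
Proof. by rewrite ltr_pwDl// mulr_ge0// subr_ge0. Qed.

Lemma Wab_weight_gt0 n : 0 < Wab_weight n.
Proof. by case: n => [|n]; rewrite sqrtr_gt0// divr_gt0. Qed.

Lemma Wab_weight_bounded : exists M, forall n, Wab_weight n <= M.
Proof.
exists (Num.sqrt a + Num.sqrt b) => -[|n] /=.
  by rewrite lerDl sqrtr_ge0.
rewrite -[leLHS]add0r lerD ?sqrtr_ge0// ler_wsqrtr// ler_pdivrMr//.
rewrite -natr1 -subr_ge0.
rewrite [leRHS](_ : _ = n%:R * (b - 1) ^+ 2); last by ring.
by rewrite mulr_ge0// sqr_ge0.
Qed.

Definition Wab_weights : shift_weights R :=
  ShiftWeights Wab_weight_gt0 Wab_weight_bounded.

End Wab.

(* Main.v *)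
Require Import Defs.
From HB Require Import structures.
From mathcomp Require Import all_boot all_order all_algebra.
From mathcomp Require Import complex.
From mathcomp Require Import ring lra.
From mathcomp Require Import all_classical all_reals all_analysis.
From mathcomp Require Import measurable_realfun.
Import Order.TTheory GRing.Theory Num.Theory.
Import numFieldNormedType.Exports.
Local Open Scope complex_scope.
Local Open Scope ring_scope.

(** Subnormality forces the weights to be nondecreasing. A normal N satisfies
    |Nx|^2 = <x, N^*Nx> <= |x||N^*Nx| = |x||N^2x|, and this inequality passes to
    restrictions ([subnormal_paranormal]); at a basis vector of a weighted
    shift it says that lambda_n <= lambda_(n+1) ([subnormal_weights_le]). For
    W_(a,b), comparing the weights 0, 1, 2 gives a <= b and b^2 <= 2b - 1,
    that is b = 1.

    Conversely, let b = 1 and a <= 1. The weights are sqrt a, 1, 1, and so on,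
    and the moments 1, a, a, ... are those of (1 - a) delta_0 + a delta_1. So
    a normal extension of W_(a,1) is the direct sum of the zero operator on a
    line C f and of the bilateral shift u_k |-> u_(k+1): e_0 is sent to
    sqrt (1 - a) f + sqrt a u_0 and e_n to u_n for n > 0
    ([flat_shift_subnormal]). This sum is again realized on l^2 of the natural
    numbers: its adjoint and itself are reindexings of the coordinates along
    mutually inverse permutations that fix 0, followed by the annihilation of
    coordinate 0 ([reindex_normal]).

    Conditional positive definiteness is a property of every subnormal
    operator, since |N^(i+j) x|^2 is the Gram matrix of the vectors
    N^*^i N^i x ([subnormal_cpd]). The types are read off the triplets (0, 0, 0)
    for a = 1 and (a - 1, 0, (1 - a) delta_0) for a < 1, and the norm is 1
    because no weight exceeds 1 while e_1 is sent to the unit vector e_2. *)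

Set Implicit Arguments.
Unset Strict Implicit.
Unset Printing Implicit Defensive.

Local Notation normc := ComplexField.Normc.normc.

(** * Normal and subnormal operators *)

Section hilbert.
Variable R : realType.

Lemma inner_conj (H : hilbertType R) (x y : H) :
  inner x y = ((inner y x)^*)%R.
Proof. by rewrite hermC expr0 mul1r. Qed.

Lemma dot_norm_inner (H : hilbertType R) (x : H) : dot_norm inner x = `|x|.
Proof.
by apply/(@pexpIrn _ 2); rewrite ?nnegrE ?dot_norm_ge0// dot_normK normr2_inner.
Qed.

Lemma inner_isometry_norm (H K : hilbertType R) (V : H -> K) :
  (forall x y, inner (V x) (V y) = inner x y) -> forall x, `|V x| = `|x|.
Proof.
by move=> Viso x; apply/(@pexpIrn _ 2); rewrite ?nnegrE// !normr2_inner Viso.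
Qed.

(** The norms of A (x + y) and of A (x + 'i y) determine the real and the
    imaginary part of <Ax, Ay>. *)
Lemma polarization (H K1 K2 : hilbertType R)
    (A : {linear H -> K1}) (B : {linear H -> K2}) :
  (forall x, `|A x| = `|B x|) ->
  forall x y, inner (A x) (A y) = inner (B x) (B y).
Proof.
move=> AB x y.
have key z w : inner (A z) (A w) + ((inner (A z) (A w))^*)%R =
               inner (B z) (B w) + ((inner (B z) (B w))^*)%R.
  have := congr1 (fun t => t ^+ 2) (AB (z + w)).
  rewrite /= !linearD /= !normr2_inner !dnormD /= -!normr2_inner !AB.
  by move/addrI.
have h1 := key x y; have := key x ('i *: y).
rewrite !linearZ /= !rmorphM /= !conjCK !conjCi => h2.
have i0 : 'i != 0 :> R[i] by exact: neq0Ci.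
move: h1 h2 i0; move: (inner (A x) _) (inner (B x) _) ('i) => u v i h1 h2 i0.
have h3 : u - (u^*)%R = v - (v^*)%R.
  apply: (mulfI i0); move: h2.
  by rewrite !mulNr !mulrBr !(addrC (- _)) => /(congr1 -%R); rewrite !opprB.
have dbl (t : R[i]) : t *+ 2 = (t + (t^*)%R) + (t - (t^*)%R) by ring.
have : u *+ 2 = v *+ 2 by rewrite !dbl h1 h3.
by move/eqP; rewrite eqrMn2r => /eqP.
Qed.

Section normal.
Variables (K : hilbertType R) (N S : boundedOp K K).
Hypotheses (NS : adjoint N S) (NSC : forall x, N (S x) = S (N x)).

Lemma adjointV x y : inner (S x) y = inner x (N y).
Proof. by rewrite inner_conj -NS -inner_conj. Qed.

(** Cauchy-Schwarz for <x, SNx>, together with |SNx| = |NNx|, which holds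
    because a normal operator and its adjoint have the same norm at every
    vector. *)
Lemma normal_paranormal x : `|N x| ^+ 2 <= `|N (N x)| * `|x|.
Proof.
have SN y : `|S y| = `|N y|.
  apply/(@pexpIrn _ 2); rewrite ?nnegrE//.
  by rewrite !normr2_inner adjointV NSC NS.
have := dot_cauchy_schwarz inner x (S (N x)).
by rewrite !dot_norm_inner SN -NS -normr2_inner ger0_norm ?exprn_ge0// mulrC.
Qed.

Lemma iter_adjoint (P Q : boundedOp K K) : adjoint P Q ->
  forall n x y, inner (iter n P x) y = inner x (iter n Q y).
Proof. by move=> PQ; elim=> //= n IH x y; rewrite PQ IH -iterSr. Qed.

Lemma iter_commute (P Q : boundedOp K K) : (forall x, P (Q x) = Q (P x)) ->
  forall m n x, iter m P (iter n Q x) = iter n Q (iter m P x).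
Proof.
move=> PQ m n x.
have PQn y : P (iter n Q y) = iter n Q (P y) by elim: n => //= n <-.
by elim: m => //= m ->.
Qed.

(** By commutation |N^(i+j) x|^2 = <S^i N^i x, S^j N^j x>: the Hankel matrix of
    the sequence |N^n x|^2 is a Gram matrix. *)
Lemma normal_iter_inner i j x :
  `|iter (i + j) N x| ^+ 2 =
  inner (iter i S (iter i N x)) (iter j S (iter j N x)).
Proof.
rewrite -(iter_adjoint NS) iter_commute// (iter_adjoint adjointV).
by rewrite -!iterD (addnC j) normr2_inner.
Qed.

End normal.

Variables (H : hilbertType R) (T : boundedOp H H).
Hypothesis subT : subnormal T.

(** The quadratic form is the squared norm of the combination, with
    coefficients alpha, of the vectors in [normal_iter_inner]. *)
Lemma subnormal_cpd : cpd T.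
Proof.
case: subT => K [V [N [Viso [S NS NSC] VT]]] h k alpha _.
have Vnorm := inner_isometry_norm Viso.
have VTn n x : V (iter n T x) = iter n N (V x) by elim: n => //= n <-.
pose y := \sum_(i < k.+1) alpha i *: iter i S (iter i N (V h)).
rewrite [leRHS](_ : _ = inner y y) ?dnorm_ge0//.
rewrite linear_sumlz; apply: eq_bigr => i _.
rewrite linear_sumr; apply: eq_bigr => j _.
rewrite -Vnorm VTn (normal_iter_inner NS NSC) linearZr_LR /=.
by rewrite [in RHS]linearZl_LR /= -mulrA mulrCA mulrA mulrC.
Qed.

Lemma subnormal_paranormal x : `|T x| ^+ 2 <= `|T (T x)| * `|x|.
Proof.
case: subT => K [V [N [Viso [S NS NSC] VT]]].
have Vnorm := inner_isometry_norm Viso.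
by rewrite -!Vnorm !VT; exact: normal_paranormal NSC _.
Qed.

End hilbert.

(** * Basis vectors and monotonicity of the weights *)

Section l2_facts.
Variable R : realType.

Lemma l2_basis_norm n : `|l2_basis R n| = 1.
Proof.
apply/eqP; rewrite eq_le; apply/andP; split.
  rewrite -[leRHS](rmorph1 (real_complex R)); apply/l2_norm_leP => // m.
  have h : \sum_(0 <= k < m) normc (l2_basis R n k) ^+ 2 =
           \sum_(0 <= k < m | k == n) 1 :> R.
    rewrite [RHS]big_mkcond; apply: eq_bigr => k _ /=; rewrite /l2_basis_seq.
    case: eqP => _; rewrite ?ComplexField.Normc.normc0 ?expr0n//.
    by rewrite ComplexField.Normc.normc1 expr1n.
  by rewrite h big_nat1_eq expr1n; case: ifP.
rewrite real_leNgt ?realE ?ler01 ?normr_ge0//; apply/negP.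
rewrite -[ltRHS](rmorph1 (real_complex R)) => /(l2_coord_le n).
by rewrite /= /l2_basis_seq eqxx ComplexField.Normc.normc1 ltxx.
Qed.

(** The inequality |Tx|^2 <= |TTx||x| at x = e_n reads
    lambda_n^2 <= lambda_n lambda_(n+1). *)
Lemma subnormal_weights_le (lam : shift_weights R) n :
  subnormal (wshift lam) -> lam n <= lam n.+1.
Proof.
move=> /subnormal_paranormal /(_ (l2_basis R n)).
rewrite /= wshift_basis linearZ /= wshift_basis !normrZ !l2_basis_norm !mulr1.
have norm_weight m : `|(lam m)%:C| = (lam m)%:C.
  by rewrite ger0_norm// lecR ltW// weight_gt0.
by rewrite !norm_weight expr2 ler_pM2l ?lecR// ltcR weight_gt0.
Qed.

End l2_facts.

(** * Normal operators that permute coordinates *)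

Section reindexing.
Variables (R : realType) (s : nat -> nat).
Hypothesis s_inj : injective s.
Implicit Types f : l2 R.

(** Coordinate 0 is annihilated: it carries the zero summand of the normal
    extension built below. *)
Definition reindex_seq (f : nat -> R[i]) n : R[i] :=
  if n is 0 then 0 else f (s n).

(** The sum on the left only meets distinct terms of the series on the right,
    as s is injective. *)
Lemma reindex_sum_le f n :
  \sum_(0 <= k < n) normc (reindex_seq f k) ^+ 2 <=
  limn (series (fun k => normc (f k) ^+ 2)).
Proof.
pose F k := normc (f k) ^+ 2.
pose M := (\max_(k < n) s k).+1.
apply: le_trans (l2_partial_sum_le f M).
apply: (@le_trans _ _ (\sum_(0 <= k < n) F (s k))).
  apply: ler_sum => -[|k] _ //.
  by rewrite [reindex_seq f 0]/(0 : R[i])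
    ComplexField.Normc.normc0 expr0n sqr_ge0.
rewrite -(big_map s xpredT F).
have -> : \sum_(j <- map s (index_iota 0 n)) F j =
          \sum_(0 <= j < M | j \in map s (index_iota 0 n)) F j.
  rewrite -[RHS]big_filter; apply: perm_big; apply: uniq_perm.
  - by rewrite map_inj_uniq// iota_uniq.
  - by rewrite filter_uniq// iota_uniq.
  move=> j; rewrite mem_filter mem_index_iota /= andb_idr//.
  case/mapP => k; rewrite mem_index_iota /= => kn ->.
  by rewrite ltnS (leq_bigmax (Ordinal kn)).
rewrite big_mkcond; apply: ler_sum => j _.
by case: ifP => // _; exact: sqr_ge0.
Qed.

Lemma reindex_seq_l2 f : reindex_seq f \in @square_summable_pred R.
Proof.
by apply/asboolP/square_summable_bounded => n; exact: reindex_sum_le.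
Qed.

Definition reindex f : l2 R := L2Seq (reindex_seq_l2 f).

Lemma reindex_is_linear : linear reindex.
Proof.
move=> a f g; apply: l2_eqP => -[|n]; rewrite l2_addE l2_scaleE //=.
by rewrite mulr0 addr0.
Qed.

HB.instance Definition _ :=
  GRing.isLinear.Build R[i] (l2 R) (l2 R) *:%R reindex reindex_is_linear.

Lemma reindex_norm_le f : `|reindex f| <= `|f|.
Proof.
rewrite -ler_sqr ?nnegrE// !l2_normr2 !l2_dotE lecR.
apply: limr_le; first exact: l2_square_summable.
by near=> n; exact: reindex_sum_le.
Unshelve. all: by end_near. Qed.

Lemma reindex_continuous : continuous reindex.
Proof.
apply/bounded_linear_continuous/linear_boundedP; exists 1.
split=> [|r r1 f]; first by rewrite realE ler01.
apply: le_trans (reindex_norm_le f) _.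
by rewrite -[leLHS]mul1r ler_wpM2r// ltW.
Qed.

HB.instance Definition _ :=
  isContinuous.Build (l2 R) (l2 R) reindex reindex_continuous.

End reindexing.

(* The orthogonal projection onto the span of the e_n with n > 0. *)
Local Notation kill0 := (reindex (@inj_id nat)).

Section reindexing_normal.
Variables (R : realType) (s t : nat -> nat).
Hypotheses (sK : cancel s t) (tK : cancel t s) (s0 : s 0 = 0%N).
Let sI := can_inj sK.
Let tI := can_inj tK.
Let t0 : t 0 = 0%N. Proof. by rewrite -s0 sK. Qed.

Lemma reindexK (f : l2 R) : reindex sI (reindex tI f) = kill0 f.
Proof.
apply: l2_eqP => -[|n] //=; case E : (s n.+1) => [|m] /=.
  by move: (sK n.+1); rewrite E t0.
by rewrite -E sK.
Qed.

Lemma reindexKV (f : l2 R) : reindex tI (reindex sI f) = kill0 f.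
Proof.
apply: l2_eqP => -[|n] //=; case E : (t n.+1) => [|m] /=.
  by move: (tK n.+1); rewrite E s0.
by rewrite -E tK.
Qed.

Lemma reindex_id (f : l2 R) : reindex sI (kill0 f) = reindex sI f.
Proof.
apply: l2_eqP => -[|n] //=; case E : (s n.+1) => [|m] //=.
by move: (sK n.+1); rewrite E t0.
Qed.

(** Reindexing along s and along its inverse are contractions that invert each
    other on the range of [kill0], so both are isometric there. *)
Lemma reindex_norm (f : l2 R) : `|reindex sI f| = `|kill0 f|.
Proof.
apply/eqP; rewrite eq_le; apply/andP; split.
  by rewrite -reindex_id reindex_norm_le.
by rewrite -reindexKV reindex_norm_le.
Qed.

(** Since [reindex sI] preserves the inner product on the range of [kill0], its
    inverse there is its adjoint; this spares the rearrangement of a series. *)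
Lemma reindex_adjoint :
  adjoint (reindex sI : boundedOp (l2 R) (l2 R)) (reindex tI).
Proof.
have Pr u (uI : injective u) (f : l2 R) :
    kill0 (reindex uI f) = reindex uI f.
  by apply: l2_eqP => -[|n].
have Padj (f g : l2 R) : inner (kill0 f) g = inner f (kill0 g).
  congr (limn (series _)); apply/funext => -[|n] //=.
  by rewrite mul0r rmorph0 mulr0.
move=> f g /=; rewrite -[reindex sI f]Pr Padj -reindexK.
rewrite (polarization reindex_norm) Padj.
by rewrite !Pr.
Qed.

Lemma reindex_normal : normal_op (reindex sI : boundedOp (l2 R) (l2 R)).
Proof.
exists (reindex tI : boundedOp (l2 R) (l2 R)); first exact: reindex_adjoint.
by move=> f /=; rewrite reindexK reindexKV.
Qed.

End reindexing_normal.

(** * The normal extension *)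

(** Index 0 stands for f, the odd index 2k + 1 for u_k and the even index
    2k + 2 for u_(-k-1). With this labelling [prev_index] maps the index of
    u_k to that of u_(k-1), so that reindexing along it sends u_k to u_(k+1). *)
Definition prev_index n :=
  match n with 0 => 0 | 1 => 2 | m.+2 => if odd m then m else n.+2 end.

Definition next_index n :=
  match n with 0 => 0 | 1 => 3 | 2 => 1 | m.+2 => if odd m then n.+2 else m end.

Lemma prev_indexK : cancel prev_index next_index.
Proof.
move=> [|[|m]] //=; case: ifP => [|h]; last by rewrite /= negbK h.
by case: m => [|[|[|m]]] //= h; rewrite -[X in if X then _ else _]negbK h.
Qed.

Lemma next_indexK : cancel next_index prev_index.
Proof.
move=> [|[|[|m]]] //=; case: ifP => [/= h|]; first by rewrite /= negbK h.
by case: m => [|m] //= h; rewrite -[odd m]negbK h.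
Qed.

Section embedding.
Variables (R : realType) (c s : R).
Hypothesis cs1 : c ^+ 2 + s ^+ 2 = 1.
Implicit Types f g : l2 R.

(** The embedding e_0 |-> c f + s u_0 and e_n |-> u_n for n > 0, in the
    labelling above. *)
Definition embed_seq (f : nat -> R[i]) k : R[i] :=
  match k with
  | 0 => c%:C * f 0
  | 1 => s%:C * f 0
  | _ => if odd k then f k./2 else 0
  end.

Lemma sum_pairs (V : zmodType) (F : nat -> V) n :
  \sum_(0 <= k < n.*2) F k = \sum_(0 <= k < n) (F k.*2 + F k.*2.+1).
Proof.
elim: n => [|n IH]; first by rewrite !big_nil.
by rewrite doubleS !big_nat_recr//= IH addrA.
Qed.

(** Coordinates 2k and 2k + 1 of the image carry together the weight of
    coordinate k: for k = 0 because c^2 + s^2 = 1, for k > 0 because only the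
    odd one is nonzero. *)
Lemma embed_pair (f g : nat -> R[i]) k :
  embed_seq f k.*2 * ((embed_seq g k.*2)^*)%R +
  embed_seq f k.*2.+1 * ((embed_seq g k.*2.+1)^*)%R = f k * ((g k)^*)%R.
Proof.
case: k => [|k] /=; last by rewrite odd_double uphalf_double mul0r add0r.
have conj_real (x : R) : ((x%:C)^*)%R = x%:C by exact: conjc_real.
rewrite !rmorphM /= !conj_real.
transitivity ((c ^+ 2 + s ^+ 2)%:C * (f 0 * ((g 0)^*)%R)).
  by rewrite rmorphD !rmorphXn; ring.
by rewrite cs1 rmorph1 mul1r.
Qed.

Lemma embed_sum (f g : nat -> R[i]) n :
  \sum_(0 <= k < n.*2) embed_seq f k * ((embed_seq g k)^*)%R =
  \sum_(0 <= k < n) f k * ((g k)^*)%R.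
Proof. by rewrite sum_pairs; apply: eq_bigr => k _; exact: embed_pair. Qed.

Lemma embed_seq_l2 f : embed_seq f \in @square_summable_pred R.
Proof.
apply/asboolP.
apply: (@square_summable_bounded _ _
  (limn (series (fun n => normc (f n) ^+ 2)))) => n.
apply: le_trans (l2_partial_sum_le f n).
have sum_normc2 (g : nat -> R[i]) m : (\sum_(0 <= k < m) normc (g k) ^+ 2)%:C =
    \sum_(0 <= k < m) g k * ((g k)^*)%R.
  rewrite raddf_sum; apply: eq_bigr => k _.
  by rewrite -normCK Defs.normcE -(rmorphXn (real_complex R)).
apply: (@le_trans _ _ (\sum_(0 <= k < n.*2) normc (embed_seq f k) ^+ 2)).
  rewrite -addnn [leRHS](big_cat_nat _ (n := n)) ?leq_addr//= lerDl.
  by apply: sumr_ge0 => k _; exact: sqr_ge0.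
by rewrite -lecR !sum_normc2 embed_sum.
Qed.

Definition embed f : l2 R := L2Seq (embed_seq_l2 f).

Lemma embed_is_linear : linear embed.
Proof.
move=> a f g; apply: l2_eqP => k; rewrite l2_addE l2_scaleE /=.
case: k => [|[|k]] /=; rewrite ?mulrDr 1?mulrCA//.
by case: ifP => _ //; rewrite mulr0 addr0.
Qed.

HB.instance Definition _ :=
  GRing.isLinear.Build R[i] (l2 R) (l2 R) *:%R embed embed_is_linear.

Lemma embed_inner f g : inner (embed f) (embed g) = inner f g.
Proof.
(* Along even indices the partial sums for the images are those for f and g. *)
apply/esym/cvg_lim; first exact: norm_hausdorff.
have dbl : (n.*2 @[n --> \oo] --> \oo)%classic.
  by under eq_cvg do rewrite -muln2; exact: cvg_mulnr.
rewrite [X in (X @ _)%classic](_ : _ =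
    (series (fun n => embed f n * ((embed g n)^*)%R) \o double)%FUN).
  exact: cvg_comp dbl (@is_cvg_l2_dot R (embed f) (embed g)).
by apply/funext => n; rewrite /= /series /= embed_sum.
Qed.

End embedding.

(** * Shifts whose weights of positive index are all 1 *)

Section flat_shift.
Variables (R : realType) (lam : shift_weights R).
Hypotheses (lam0 : lam 0 <= 1) (lamS : forall n, lam n.+1 = 1).

(** The bilateral shift plus 0 extends the shift for s = lambda_0 and
    c = sqrt (1 - lambda_0^2): the component of e_0 along f is annihilated at
    the first step, and s u_0 is sent to s u_1, the image of lambda_0 e_1. *)
Lemma flat_shift_subnormal : subnormal (wshift lam).
Proof.
have l0 : 0 <= lam 0 by rewrite ltW ?weight_gt0.
have cs1 : Num.sqrt (1 - lam 0 ^+ 2) ^+ 2 + lam 0 ^+ 2 = 1.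
  by rewrite sqr_sqrtr ?subrK// subr_ge0 expr_le1.
exists (l2 R), (embed cs1), (reindex (can_inj prev_indexK)); split.
- exact: embed_inner.
- exact: reindex_normal prev_indexK next_indexK erefl.
move=> f /=; apply: l2_eqP => -[|[|k]] /=; rewrite ?mulr0//.
rewrite negbK; case: ifP => ok; last by rewrite /= !negbK ok.
by case: k ok => [|[|k]] //= ->; rewrite ?lamS ?rmorph1 ?mul1r.
Qed.

Lemma flat_shift_norm_le f : `|wshift lam f| <= `|f|.
Proof.
by rewrite -[leRHS]mul1r; apply: wshift_norm_le => -[|n]; rewrite ?lamS.
Qed.

Lemma flat_shift_opnorm : opnorm (wshift lam) = 1.
Proof.
pose A := [set complex.Re `|wshift lam x| |
  x in [set x : l2 R | `|x| <= 1]]%classic.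
have A1 : A 1.
  exists (l2_basis R 1); rewrite /= ?l2_basis_norm//.
  by rewrite wshift_basis lamS rmorph1 scale1r l2_basis_norm.
have Aub : ubound A 1.
  move=> _ [f /= f1 <-].
  by have := le_trans (flat_shift_norm_le f) f1; rewrite lecE => /andP[].
apply/eqP; rewrite eq_le; apply/andP; split.
  by apply: ge_sup => //; exists 1.
by apply: ub_le_sup => //; exists 1.
Qed.

Lemma flat_lambda_hat n : lambda_hat lam n.+1 = lam 0 ^+ 2.
Proof.
rewrite /lambda_hat big_ord_recl big1 ?mulr1// => k _.
by rewrite lamS expr1n.
Qed.

Lemma flat_shift_isometric : lam 0 = 1 -> isometric (wshift lam).
Proof.
move=> lam01 f; apply/eqP; rewrite eq_le flat_shift_norm_le /=.
have lam1 n : lam n = 1 by case: n.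
rewrite -ler_sqr ?nnegrE// !l2_normr2 !l2_dotE lecR.
apply: limr_le; first exact: l2_square_summable.
near=> n; apply: le_trans (l2_partial_sum_le _ n.+1).
rewrite big_nat_recl//= expr0n addr0 sqrtr0 expr0n add0r.
by apply: ler_sum => k _; rewrite lam1 rmorph1 mul1r.
Unshelve. all: by end_near. Qed.

End flat_shift.

(** * Scalar representing triplets *)

Section triplets.
Variables (R : realType) (lam : shift_weights R).
Hypothesis lamS : forall n, lam n.+1 = 1.

Lemma flat_scalar_triplet_zero : lam 0 = 1 -> scalar_triplet lam 0 0 mzero.
Proof.
move=> lam01; split=> //.
- rewrite (_ : msupport _ = set0); first exact: compact0.
  apply/seteqP; split=> // x /(_ setT openT Logic.I).
  by rewrite ltxx.
move=> n; rewrite integral_measure_zero adde0 !mul0r !addr0; congr EFin.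
case: n => [|n]; first by rewrite /lambda_hat big_ord0.
by rewrite flat_lambda_hat// lam01 expr1n.
Qed.

Lemma Qpoly0 n : Qpoly n.+1 0 = n%:R :> R.
Proof.
rewrite /Qpoly; case: n => [|n]; first by rewrite big_ord0.
rewrite big_ord_recl big1 ?addr0 ?expr0 ?mulr1 ?subn0 ?subn1// => k _.
by rewrite expr0n mulr0.
Qed.

Variable c : {nonneg R}.

Lemma mscale_diracE (A : set R) :
  (mscale c \d_(0 : R) : {finite_measure set R -> \bar R}) A =
  (c%:num * (0 \in A)%:R)%:E.
Proof. by rewrite EFinM -diracE. Qed.

Lemma msupport_dirac :
  0 < c%:num -> msupport (mscale c \d_(0 : R)) = [set 0]%classic.
Proof.
move=> c0; apply/seteqP; split=> [x xs|_ -> U oU U0].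
  apply: contrapT => /eqP x0.
  have := xs _ (@open_neq _ 0) x0.
  by rewrite mscale_diracE memNset ?mulr0 ?ltxx//= eqxx.
by rewrite mscale_diracE mem_set// mulr1 lte_fin.
Qed.

Lemma integral_Qpoly_dirac n :
  (\int[mscale c \d_(0%R : R)]_(x in `[0%R, +oo[) (Qpoly n x)%:E =
   (c%:num * Qpoly n 0)%R%:E)%E.
Proof.
have mI : measurable `[0%R : R, +oo[%classic by exact: measurable_itv.
have mQ : measurable_fun `[0%R : R, +oo[%classic (@Qpoly R n).
  apply: measurable_sum => j.
  apply: measurable_funM; first exact: measurable_cst.
  exact: exprn_measurable.
move/measurable_EFinP: mQ => mQ.
rewrite ge0_integral_mscale// => [|x /=].
  rewrite integral_dirac// diracE mem_set ?mul1e ?EFinM//=.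
  by rewrite in_itv /= lexx.
rewrite in_itv /= andbT lee_fin => x0.
by apply: sumr_ge0 => j _; rewrite mulr_ge0// exprn_ge0.
Qed.

(** With a = lambda_0^2, the moment of index n + 1 is
    1 + (a - 1)(n + 1) + (1 - a) n = a, as [Qpoly0] gives Q_(n+1)(0) = n. *)
Lemma flat_scalar_triplet_dirac : c%:num = 1 - lam 0 ^+ 2 -> 0 < c%:num ->
  scalar_triplet lam (lam 0 ^+ 2 - 1) 0 (mscale c \d_(0 : R)).
Proof.
move=> cE c0; split=> //.
- by rewrite mscale_diracE memNset ?mulr0//= in_itv /= lexx.
- by rewrite msupport_dirac//; exact: compact_set1.
- by rewrite mscale_diracE memNset ?mulr0//= => /esym/eqP; rewrite oner_eq0.
move=> n; rewrite integral_Qpoly_dirac -EFinD cE; congr EFin.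
case: n => [|n]; first by rewrite /lambda_hat /Qpoly !big_ord0; ring.
by rewrite flat_lambda_hat// Qpoly0 -natr1; ring.
Qed.

End triplets.

Theorem corollary2p4p3 (R : realType) (a b : R) (a_gt0 : 0 < a) (b_ge1 : 1 <= b) :
  [/\ subnormal (wshift (Wab_weights a_gt0 b_ge1)) <-> (a <= b /\ b = 1),
      a = b /\ b = 1 ->
        isometric (wshift (Wab_weights a_gt0 b_ge1)) /\
        type_I (Wab_weights a_gt0 b_ge1),
      a < b /\ b = 1 -> type_II (Wab_weights a_gt0 b_ge1)
    & subnormal (wshift (Wab_weights a_gt0 b_ge1)) ->
        opnorm (wshift (Wab_weights a_gt0 b_ge1)) = 1].
Proof.
set lam := Wab_weights a_gt0 b_ge1.
have lamS : b = 1 -> forall n, lam n.+1 = 1.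
  by move=> b1 n; rewrite /lam /= b1 subrr !mulr0 addr0 divr1 sqrtr1.
have lam0 : lam 0 ^+ 2 = a by rewrite sqr_sqrtr// ltW.
have lam0_le : a <= 1 -> lam 0 <= 1 by move=> a1; rewrite -sqrtr1 ler_wsqrtr.
have subP : subnormal (wshift lam) <-> a <= b /\ b = 1.
  split=> [sub_lam|[ab b1]]; last first.
    by apply: flat_shift_subnormal (lamS b1); rewrite lam0_le// -b1.
  have le01 := subnormal_weights_le 0 sub_lam.
  have le12 := subnormal_weights_le 1 sub_lam.
  have b0 : 0 < b by rewrite (lt_le_trans ltr01).
  have {}le01 : a <= b.
    move: le01; rewrite /lam /= mul1r mul0r addr0 divr1 (addrC 1) subrK.
    by rewrite ler_sqrt// ltW.
  split=> //; move: le12.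
  rewrite /lam /= mul0r mul1r addr0 divr1 (addrC 1 (b - 1)) subrK.
  rewrite ler_sqrt; last by rewrite divr_ge0//; lra.
  (* lambda_1 <= lambda_2 now reads b^2 <= 1 + 2 (b - 1), i.e.
     (b - 1)^2 <= 0. *)
  by rewrite ler_pdivlMr// => h; apply/eqP; nra.
split=> //.
- move=> [ab b1]; have lam01 : lam 0 = 1 by rewrite /lam /= ab b1 sqrtr1.
  split.
  - apply: flat_shift_isometric; rewrite ?lam01//; exact: lamS.
  split; first by apply/subnormal_cpd/subP; rewrite ab.
  exists 0, 0, mzero; split=> //.
  exact: flat_scalar_triplet_zero (lamS b1) lam01.
- move=> [ab b1].
  have c0 : 0 < 1 - lam 0 ^+ 2 by rewrite lam0 subr_gt0 -b1.
  split; first by apply/subnormal_cpd/subP; rewrite ltW.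
  exists (lam 0 ^+ 2 - 1), 0, (mscale (NngNum (ltW c0)) \d_(0 : R)); split=> //.
    by apply: flat_scalar_triplet_dirac => //; exact: lamS.
  exact: msupport_dirac.
move=> /subP[ab b1]; apply: flat_shift_opnorm (lamS b1).
by rewrite lam0_le -?b1.
Qed.
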